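(* Let $n=8$. For $T\in\mathcal{C}_B(\mathbb{R}^8)$ put $$S:=l_{\tilde a_{max},\tilde b_{max}}^{-1}\bigl(l_{a_{max},b_{max}}(T)\bigr),\qquad b_{max}=\tfrac1{18},\quad a_{max}=\tfrac{49}{738},\quad \tilde b_{max}=\tfrac1{40},\quad \tilde a_{max}=\tfrac{43}{1600},$$ let $s=\sqrt{2\tilde a_{max}}=\frac{\sqrt{86}}{40}$, and for an orthonormal four-frame $\{e_1,e_2,e_3,e_4\}$ and $\lambda\in[0,1]$ set $$L_\lambda(T):=S_{1313}+S_{2323}+\lambda^2\bigl(S_{1414}+S_{2424}\bigr)-2\lambda S_{1234}+s(1-\lambda^2)\bigl(\mathrm{Ric}(S)_{11}+\mathrm{Ric}(S)_{22}\bigr).$$ Then $L_\lambda(T)\ge0$ for every weakly PIC $T\in\mathcal{C}_B(\mathbb{R}^8)$, every orthonormal four-frame, and every $\lambda\in[0,1]$.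
   Context: $\mathcal{C}_B(\mathbb{R}^n)$ is the space of algebraic curvature operators: symmetric bilinear forms $R$ on $\Lambda^2\mathbb{R}^n$ satisfying the first Bianchi identity, with components $R_{ijkl}=R(e_i\wedge e_j,e_k\wedge e_l)$ in an orthonormal frame, $\mathrm{Ric}(R)_{ik}=\sum_pR_{ipkp}$, $\mathrm{scal}(R)=\sum_i\mathrm{Ric}(R)_{ii}$. $T$ is weakly PIC if $T_{1313}+T_{1414}+T_{2323}+T_{2424}-2T_{1234}\ge0$ for every orthonormal four-frame. For symmetric two-tensors, $(A\wedge B)_{ijkl}=A_{ik}B_{jl}+A_{jl}B_{ik}-A_{il}B_{jk}-A_{jk}B_{il}$. For $0\le b\le a$, $l_{a,b}:\mathcal{C}_B(\mathbb{R}^n)\to\mathcal{C}_B(\mathbb{R}^n)$ is the (invertible) linear map $l_{a,b}(R)=R+b\,\mathrm{Ric}(R)\wedge\mathrm{id}+\frac{a-b}{n}\mathrm{scal}(R)\,\mathrm{id}\wedge\mathrm{id}$. *)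

(* Defs.v *)
From HB Require Import structures.
From mathcomp Require Import all_boot all_order all_algebra.
From mathcomp Require Import boolp classical_sets reals.
From mathcomp Require Import ring lra.
Set Implicit Arguments.
Unset Strict Implicit.
Unset Printing Implicit Defensive.
Import Order.TTheory GRing.Theory Num.Theory.
Local Open Scope ring_scope.

Section Curvature.
Variables (R : realType) (n : nat).

Definition tensor4 := {ffun 'I_n * 'I_n * 'I_n * 'I_n -> R^o}.

(* A bilinear form on the second exterior power of R^n is the same thing as a
   4-tensor that is alternating in its first two and in its last two arguments,
   via T (i, j, k, l) = T (e_i /\ e_j, e_k /\ e_l) for the standard basis e.
   Alternation in (k, l) follows from the first two conditions. *)
Definition is_curv : {pred tensor4} := fun T =>
  [forall i, forall j, forall k, forall l,
    [&& T (i, j, k, l) == - T (j, i, k, l),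
        T (i, j, k, l) == T (k, l, i, j) &
        T (i, j, k, l) + T (j, k, i, l) + T (k, i, j, l) == 0]].

Lemma is_curvP (T : tensor4) :
  reflect (forall i j k l,
    [/\ T (i, j, k, l) = - T (j, i, k, l), T (i, j, k, l) = T (k, l, i, j) &
        T (i, j, k, l) + T (j, k, i, l) + T (k, i, j, l) = 0])
    (T \in is_curv).
Proof.
apply: (iffP idP) => [H i j k l|H].
  move: H => /forallP/(_ i)/forallP/(_ j)/forallP/(_ k)/forallP/(_ l).
  by move=> /and3P[/eqP ? /eqP ? /eqP ?].
apply/forallP => i; apply/forallP => j; apply/forallP => k; apply/forallP => l.
by have [? ? ?] := H i j k l; apply/and3P; split; apply/eqP.
Qed.

Fact is_curv_submod : submod_closed is_curv.
Proof.
split; first by apply/is_curvP => i j k l; rewrite !ffunE !addr0 oppr0.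
move=> c S T /is_curvP HS /is_curvP HT; apply/is_curvP => i j k l.
have [S1 S2 S3] := HS i j k l; have [T1 T2 T3] := HT i j k l.
rewrite !ffunE; split.
- by rewrite S1 T1 scalerN opprD.
- by rewrite S2 T2.
- have -> : forall x y z x' y' z' : R^o,
    c *: x + x' + (c *: y + y') + (c *: z + z') = c *: (x + y + z) + (x' + y' + z').
    by move=> x y z x' y' z'; rewrite !scalerDr; ring.
  by rewrite S3 T3 scaler0 addr0.
Qed.
HB.instance Definition _ := GRing.isSubmodClosed.Build R tensor4 is_curv
  is_curv_submod.

Record curv := Curv { curv_val :> tensor4; curv_prop : curv_val \in is_curv }.

HB.instance Definition _ := [isSub for curv_val].
HB.instance Definition _ := [Choice of curv by <:].
HB.instance Definition _ := [SubChoice_isSubLmodule of curv by <:].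

Definition Ric (T : tensor4) : 'M[R]_n :=
  \matrix_(i, k) \sum_p T (i, p, k, p).

Definition scal (T : tensor4) : R := \tr (Ric T).

Definition KN (A B : 'M[R]_n) : tensor4 :=
  [ffun x => let '(i, j, k, l) := x in
     A i k * B j l + A j l * B i k - A i l * B j k - A j k * B i l].

Definition lab_tensor (a b : R) (T : tensor4) : tensor4 :=
  T + b *: KN (Ric T) 1%:M + ((a - b) / n%:R * scal T) *: KN 1%:M 1%:M.

Lemma Ric_sym (T : curv) : (Ric T)^T = Ric T.
Proof.
apply/matrixP => i k; rewrite !mxE; apply: eq_bigr => p _.
by have [_ -> _] := is_curvP _ (curv_prop T) k p i p.
Qed.

Lemma KN_curv (A : 'M[R]_n) : A^T = A -> KN A 1%:M \in is_curv.
Proof.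
move=> As; have sA i j : A i j = A j i by rewrite -{1}As mxE.
have s1 i j : (1%:M : 'M[R]_n) i j = (1%:M : 'M[R]_n) j i by rewrite !mxE eq_sym.
apply/is_curvP => i j k l; rewrite !ffunE.
split.
- ring.
- rewrite (sA k i) (sA l j) (sA k j) (sA l i) (s1 k i) (s1 l j) (s1 k j) (s1 l i).
  ring.
- rewrite (sA k i) (sA j i) (sA k j) (s1 k i) (s1 j i) (s1 k j).
  ring.
Qed.

Fact lab_curv a b (T : curv) : lab_tensor a b T \in is_curv.
Proof.
rewrite /lab_tensor !rpredD ?rpredZ ?KN_curv ?curv_prop ?Ric_sym //.
exact: trmx1.
Qed.

Definition lab (a b : R) (T : curv) : curv := Curv (lab_curv a b T).

Lemma RicD (S T : tensor4) : Ric (S + T) = Ric S + Ric T.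
Proof.
apply/matrixP => i k; rewrite !mxE -big_split /=.
by apply: eq_bigr => p _; rewrite ffunE.
Qed.

Lemma RicZ c (T : tensor4) : Ric (c *: T) = c *: Ric T.
Proof.
by apply/matrixP => i k; rewrite !mxE mulr_sumr; apply: eq_bigr => p _; rewrite ffunE.
Qed.

Lemma KND (A B C : 'M[R]_n) : KN (A + B) C = KN A C + KN B C.
Proof. by apply/ffunP => -[[[i j] k] l]; rewrite !ffunE !mxE; ring. Qed.

Lemma KNZ c (A C : 'M[R]_n) : KN (c *: A) C = c *: KN A C.
Proof.
apply/ffunP => -[[[i j] k] l]; rewrite !ffunE !mxE /GRing.scale /=; ring.
Qed.

Fact lab_linear a b : linear (lab a b).
Proof.
move=> c S T; apply: val_inj; rewrite /= /lab_tensor /scal /=.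
rewrite RicD RicZ KND KNZ mxtraceD mxtraceZ.
apply/ffunP => x; rewrite !ffunE /GRing.scale /=; ring.
Qed.
HB.instance Definition _ a b := GRing.isLinear.Build R curv curv _ (lab a b)
  (lab_linear a b).

Lemma Ric_KN1 (A : 'M[R]_n) : Ric (KN A 1%:M) = (n%:R - 2) *: A + (\tr A)%:M.
Proof.
apply/matrixP => i k; rewrite !mxE.
under eq_bigr do rewrite ffunE !mxE eqxx mulr1.
rewrite !sumrB !big_split /= sumr_const card_ord -mulr_suml -/(\tr A).
have -> : \sum_(p < n) A i p * (p == k)%:R = A i k.
  by rewrite (bigD1 k) //= eqxx mulr1 big1 ?addr0 // => p /negbTE ->; rewrite mulr0.
have -> : \sum_(p < n) A p k * (i == p)%:R = A i k.
  rewrite (bigD1 i) //= eqxx mulr1 big1 ?addr0 // => p /negbTE.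
  by rewrite eq_sym => ->; rewrite mulr0.
rewrite -mulr_natr -[in RHS]mulr_natr; ring.
Qed.

Lemma lab_bij a b : 0 <= b <= a -> (1 < n)%N -> bijective (lab a b).
Proof.
case/andP=> b0 ba n1.
have n2 : 2 <= n%:R :> R by rewrite ler_nat.
have nN0 : n%:R != 0 :> R by lra.
pose u := 1 + 2 * (n%:R - 1) * a; pose v := 1 + b * (n%:R - 2).
have uN0 : u != 0.
  have : 0 <= (n%:R - 1) * a by apply: mulr_ge0; lra.
  rewrite /u => ?; lra.
have vN0 : v != 0.
  have : 0 <= b * (n%:R - 2) by apply: mulr_ge0; lra.
  rewrite /v => ?; lra.
have sE c (i k : 'I_n) : c%:M i k = c * (i == k)%:R by rewrite mxE mulr_natr.
  have RicL (T : tensor4) : Ric (lab_tensor a b T) =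
    v *: Ric T + ((b + 2 * (n%:R - 1) * (a - b) / n%:R) * scal T)%:M.
  rewrite /lab_tensor !RicD !RicZ !Ric_KN1 mxtrace1.
  apply/matrixP => i k; rewrite /scal !(sE, mxE) /v; ring.
have scalL (T : tensor4) : scal (lab_tensor a b T) = u * scal T.
  rewrite /scal RicL linearD linearZ /= mxtrace_scalar -/(scal T) /u /v.
  by rewrite -mulr_natr /GRing.scale /=; field.
pose w := b + 2 * (n%:R - 1) * (a - b) / n%:R.
pose sc (T : tensor4) := scal T / u.
pose rc (T : tensor4) := v^-1 *: (Ric T - (w * sc T)%:M).
pose gt (T : tensor4) : tensor4 :=
  T - b *: KN (rc T) 1%:M - ((a - b) / n%:R * sc T) *: KN 1%:M 1%:M.
have gP (T : curv) : gt T \in is_curv.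
  rewrite /gt !rpredB ?rpredZ ?KN_curv ?curv_prop ?trmx1 //.
  by rewrite /rc linearZ linearB /= tr_scalar_mx Ric_sym.
have trrc (T : tensor4) : \tr (rc T) = sc T.
  rewrite /rc linearZ linearB /= mxtrace_scalar -/(scal T).
  have -> : scal T = u * sc T by rewrite /sc mulrCA divff ?mulr1.
  rewrite -mulr_natr /GRing.scale /=.
  have -> : u * sc T - w * sc T * n%:R = v * sc T.
    by rewrite /u /w /v; field.
  by rewrite mulKf.
have RicG (T : tensor4) : Ric (gt T) = rc T.
  rewrite /gt -!scaleNr !RicD !RicZ !Ric_KN1 mxtrace1 trrc.
  have -> : Ric T = v *: rc T + (w * sc T)%:M.
    by rewrite /rc scalerA divff // scale1r subrK.
  apply/matrixP => i k; rewrite !(sE, mxE) /v /w; ring.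
exists (fun T => Curv (gP T)) => T; apply: val_inj => /=.
- have scE : sc (lab_tensor a b T) = scal T by rewrite /sc scalL mulrC mulKf.
  have rcE : rc (lab_tensor a b T) = Ric T.
    by rewrite /rc scE RicL -/w addrK scalerA mulVf // scale1r.
  rewrite /gt scE rcE /lab_tensor.
  by rewrite addrAC !addrK.
- rewrite /lab_tensor /scal RicG trrc /gt.
  by rewrite addrAC !subrK.
Qed.

(* The S with lab a b S = T; by lab_bij it exists and is unique whenever
   0 <= b <= a and 1 < n (and it is the junk value 0 if there is no such S). *)
Definition lab_inv (a b : R) (T : curv) : curv :=
  xget 0 [set S : curv | lab a b S = T].

Lemma labK a b : 0 <= b <= a -> (1 < n)%N -> cancel (lab a b) (lab_inv a b).
Proof.
move=> ab n1 S; apply: (bij_inj (lab_bij ab n1)).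
exact: (@xgetPex _ 0 [set S' | lab a b S' = lab a b S] (ex_intro _ S erefl)).
Qed.

Lemma lab_invK a b : 0 <= b <= a -> (1 < n)%N -> cancel (lab_inv a b) (lab a b).
Proof.
move=> ab n1 T; have [g _ gK] := lab_bij ab n1.
exact: (@xgetPex _ 0 [set S' | lab a b S' = T] (ex_intro _ (g T) (gK T))).
Qed.

Definition dot (u v : 'rV[R]_n) : R := (u *m v^T) 0 0.

Definition orthonormal_seq (s : seq 'rV[R]_n) : Prop :=
  forall i j, (i < size s)%N -> (j < size s)%N -> dot s`_i s`_j = (i == j)%:R.

(* T (x /\ y, z /\ w), by multilinear extension from the standard basis: the
   component T_{ijkl} in a frame (e_i) is eval4 T e_i e_j e_k e_l. *)
Definition eval4 (T : tensor4) (x y z w : 'rV[R]_n) : R :=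
  \sum_i \sum_j \sum_k \sum_l T (i, j, k, l) * x 0 i * y 0 j * z 0 k * w 0 l.

Definition eval2 (A : 'M[R]_n) (x y : 'rV[R]_n) : R := (x *m A *m y^T) 0 0.

Definition weakly_PIC (T : tensor4) : Prop :=
  forall e1 e2 e3 e4 : 'rV[R]_n, orthonormal_seq [:: e1; e2; e3; e4] ->
    0 <= eval4 T e1 e3 e1 e3 + eval4 T e1 e4 e1 e4
       + eval4 T e2 e3 e2 e3 + eval4 T e2 e4 e2 e4
       - 2 * eval4 T e1 e2 e3 e4.

End Curvature.

(* Main.v *)
Require Import Defs.
From mathcomp Require Import all_boot all_order all_algebra.
From mathcomp Require Import reals.
From mathcomp Require Import ring lra.
Import Order.TTheory GRing.Theory Num.Theory.
Local Open Scope ring_scope.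

(* Write A = S_1313 + S_2323 + s (Ric(S)_11 + Ric(S)_22), w = S_1234 and let P be
   the isotropic curvature of S on the frame.  Then
     L_lambda = (1 - lambda)^2 A + 2 lambda (1 - lambda) (A - w) + lambda^2 P,
   so it is enough that A - w, A + w and P are nonnegative.  The composition of
   the inverse of one l_{a,b} with another is again an l_{a,b}, so S is
   T + b Ric(T) /\ id + c scal(T) id /\ id with explicit b and c.  Extending the
   frame to an orthonormal basis, Ric(T) and scal(T) become sums of sectional
   curvatures K_ij of T, and T_1234 enters only through A -+ w.  It is
   controlled by the isotropic curvature of T on the tilted frames
   (e_1, e_2, e_3, +- e_4 / 2 + sqrt 3 / 2 e_p), 5 <= p <= 8; what is left is a
   nonnegative combination of the inequalities
   K_ik + K_il + K_jk + K_jl >= 0 for distinct i, j, k, l. *)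

(** * Multilinear evaluation of curvature tensors on vectors *)

Section Multilinear.
Context {R : realType} {n : nat}.
Implicit Types (T : tensor4 R n) (A B : 'M[R]_n) (x y z w u v : 'rV[R]_n).

Lemma dotE x y : dot x y = \sum_i x 0 i * y 0 i.
Proof. by rewrite /dot mxE; apply: eq_bigr => i _; rewrite !mxE. Qed.

Lemma dotC x y : dot x y = dot y x.
Proof. by rewrite !dotE; apply: eq_bigr => i _; rewrite mulrC. Qed.

Lemma dot_linr a b x u v : dot x (a *: u + b *: v) = a * dot x u + b * dot x v.
Proof.
rewrite !dotE !mulr_sumr -big_split; apply: eq_bigr => i _ /=.
by rewrite !mxE; ring.
Qed.

Lemma dot_gt0 x : x != 0 -> 0 < dot x x.
Proof.
move=> x0; rewrite lt0r dotE sumr_ge0 ?andbT; last first.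
  by move=> i _; rewrite -expr2 sqr_ge0.
apply: contra x0 => /eqP x0; apply/eqP/rowP => i; rewrite mxE; apply/eqP.
have /(_ _ i isT) := psumr_eq0P _ x0.
by move=> /(_ (fun j _ => sqr_ge0 (x 0 j))) /eqP; rewrite mulf_eq0 orbb.
Qed.

Lemma eval2E A x y : eval2 A x y = \sum_i \sum_k A i k * x 0 i * y 0 k.
Proof.
rewrite /eval2 mxE exchange_big; apply: eq_bigr => k _; rewrite !mxE mulr_suml.
by apply: eq_bigr => i _; rewrite (mulrC (A i k)).
Qed.

Lemma eval2D A B x y : eval2 (A + B) x y = eval2 A x y + eval2 B x y.
Proof. by rewrite /eval2 mulmxDr mulmxDl mxE. Qed.

Lemma eval2Z c A x y : eval2 (c *: A) x y = c * eval2 A x y.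
Proof. by rewrite /eval2 -scalemxAr -scalemxAl mxE. Qed.

Lemma eval2_1 x y : eval2 1%:M x y = dot x y.
Proof. by rewrite /eval2 mulmx1. Qed.

Lemma eval4D S T x y z w :
  eval4 (S + T) x y z w = eval4 S x y z w + eval4 T x y z w.
Proof.
rewrite /eval4; do 4 (rewrite -big_split; apply: eq_bigr => ? _ /=).
by rewrite ffunE; ring.
Qed.

Lemma eval4Z c T x y z w : eval4 (c *: T) x y z w = c * eval4 T x y z w.
Proof.
rewrite /eval4; do 4 (rewrite mulr_sumr; apply: eq_bigr => ? _ /=).
by rewrite ffunE /GRing.scale /= !mulrA.
Qed.

Lemma eval4_lin2 T x a u b v z w :
  eval4 T x (a *: u + b *: v) z w = a * eval4 T x u z w + b * eval4 T x v z w.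
Proof.
rewrite /eval4; do 4 (rewrite !mulr_sumr -big_split; apply: eq_bigr => ? _ /=).
by rewrite !mxE; ring.
Qed.

Lemma eval4_lin4 T x y z a u b v :
  eval4 T x y z (a *: u + b *: v) = a * eval4 T x y z u + b * eval4 T x y z v.
Proof.
rewrite /eval4; do 4 (rewrite !mulr_sumr -big_split; apply: eq_bigr => ? _ /=).
by rewrite !mxE; ring.
Qed.

Lemma eval4_KN A B x y z w :
  eval4 (KN A B) x y z w = eval2 A x z * eval2 B y w + eval2 A y w * eval2 B x z
    - eval2 A x w * eval2 B y z - eval2 A y z * eval2 B x w.
Proof.
(* [E] and [F] expand both kinds of products in the same order of summation over [i], [j], [k], [l],
   so that the claim can be checked summand by summand. *)
have E C D : eval2 C x z * eval2 D y w = \sum_i \sum_j \sum_k \sum_l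
    C i k * D j l * x 0 i * y 0 j * z 0 k * w 0 l.
  rewrite !eval2E mulr_suml; apply: eq_bigr => i _; rewrite mulr_sumr.
  apply: eq_bigr => j _; rewrite mulr_suml; apply: eq_bigr => k _.
  by rewrite mulr_sumr; apply: eq_bigr => l _; ring.
have F C D : eval2 C x w * eval2 D y z = \sum_i \sum_j \sum_k \sum_l
    C i l * D j k * x 0 i * y 0 j * z 0 k * w 0 l.
  rewrite !eval2E mulr_suml; apply: eq_bigr => i _; rewrite mulr_sumr.
  apply: eq_bigr => j _; rewrite exchange_big mulr_suml; apply: eq_bigr => l _.
  by rewrite mulr_sumr; apply: eq_bigr => k _; ring.
rewrite (mulrC (eval2 A y w)) (mulrC (eval2 A y z)) !E !F /eval4.
do 4 (rewrite -!(sumrB, big_split); apply: eq_bigr => ? _ /=).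
by rewrite ffunE; ring.
Qed.

Lemma eval4_anti (T : curv R n) x y z w : eval4 T x y z w = - eval4 T y x z w.
Proof.
rewrite /eval4 exchange_big -sumrN; apply: eq_bigr => j _.
rewrite -sumrN; apply: eq_bigr => i _; rewrite -sumrN; apply: eq_bigr => k _.
rewrite -sumrN; apply: eq_bigr => l _.
by have [-> _ _] := is_curvP _ (curv_prop T) i j k l; rewrite !mulNr; ring.
Qed.

Lemma eval4_swap (T : curv R n) x y z w : eval4 T x y z w = eval4 T z w x y.
Proof.
rewrite /eval4 pair_big /= [RHS]pair_big /=.
under eq_bigr => p _ do rewrite pair_big /=.
under [RHS]eq_bigr => p _ do rewrite pair_big /=.
rewrite exchange_big; apply: eq_bigr => -[k l] _; apply: eq_bigr => -[i j] _ /=.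
by have [_ -> _] := is_curvP _ (curv_prop T) i j k l; ring.
Qed.

(** On an orthonormal pair this is the sectional curvature of the plane; there is no division by the
    squared area of [x] and [y]. *)
Definition sec T x y := eval4 T x y x y.

Lemma secC (T : curv R n) x y : sec T x y = sec T y x.
Proof.
by rewrite /sec eval4_anti [eval4 T y x x y]eval4_swap eval4_anti opprK.
Qed.

Lemma sec_xx (T : curv R n) x : sec T x x = 0.
Proof. by have := eval4_anti T x x x x; rewrite /sec; lra. Qed.

Lemma sec_lin T x a u b v :
  sec T x (a *: u + b *: v) = a ^+ 2 * sec T x u + b ^+ 2 * sec T x v
    + a * b * (eval4 T x u x v + eval4 T x v x u).
Proof. by rewrite /sec eval4_lin2 !eval4_lin4; ring. Qed.

End Multilinear.

(** * Orthonormal bases, and traces computed in them *)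

Section Orthonormal.
Context {R : realType} {n : nat}.
Implicit Types (T : tensor4 R n) (A B : 'M[R]_n) (x y z w u v : 'rV[R]_n).

Lemma orthonormal_rcons (s : seq 'rV[R]_n) v : orthonormal_seq s ->
  dot v v = 1 -> (forall i, (i < size s)%N -> dot s`_i v = 0) ->
  orthonormal_seq (rcons s v).
Proof.
move=> so vv vs i j; rewrite size_rcons !ltnS !nth_rcons.
rewrite leq_eqVlt [(j <= _)%N]leq_eqVlt => /predU1P[->|si] /predU1P[->|sj].
- by rewrite ltnn !eqxx.
- by rewrite ltnn eqxx sj dotC vs // gtn_eqF.
- by rewrite ltnn eqxx si vs // ltn_eqF.
- by rewrite si sj so.
Qed.

Lemma orthonormal_extend1 (s : seq 'rV[R]_n) : (size s < n)%N ->
  orthonormal_seq s -> exists v, orthonormal_seq (rcons s v).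
Proof.
move=> sn so; pose A := \matrix_(i < size s) s`_i.
(* The rows of [kermx A^T] are orthogonal to every vector of [s], and one of them is nonzero because
   the rank of [A] is at most [size s < n]. *)
pose u := nz_row (kermx A^T).
have u0 : u != 0.
  rewrite nz_row_eq0 -mxrank_eq0 mxrank_ker mxrank_tr subn_eq0 -ltnNge.
  exact: leq_ltn_trans (rank_leq_row _) sn.
have us i : (i < size s)%N -> dot u s`_i = 0.
  move=> si; have /sub_kermxP/rowP/(_ (Ordinal si)) := nz_row_sub (kermx A^T).
  rewrite !mxE dotE => uA; rewrite -[RHS]uA.
  by apply: eq_bigr => j _; rewrite !mxE.
pose r := Num.sqrt (dot u u).
have uu := dot_gt0 _ u0.
have r0 : r != 0 by rewrite gt_eqF // sqrtr_gt0.
have r2 : r ^+ 2 = dot u u by rewrite sqr_sqrtr // ltW.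
have vE x : dot x (r^-1 *: u) = r^-1 * dot x u.
  by have := dot_linr r^-1 0 x u u; rewrite scale0r addr0 mul0r addr0.
exists (r^-1 *: u); apply: orthonormal_rcons => // [|k sk].
  by rewrite vE dotC vE -r2 expr2 mulKf // mulVf.
by rewrite vE dotC us ?mulr0.
Qed.

Lemma orthonormal_extend (s : seq 'rV[R]_n) m : (size s + m <= n)%N ->
  orthonormal_seq s ->
  exists t, size t = m /\ orthonormal_seq (s ++ t).
Proof.
elim: m => [_ so|m IH]; first by exists [::]; rewrite cats0.
rewrite addnS => smn so; have [t [tm sto]] := IH (ltnW smn) so.
have [|v] := orthonormal_extend1 _ _ sto; first by rewrite size_cat tm.
by rewrite rcons_cat => ?; exists (rcons t v); rewrite size_rcons tm.
Qed.

(** The matrix [Q] with rows [s] is square, so its right inverse [Q^T] is also a left inverse. *)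
Lemma parseval (s : seq 'rV[R]_n) : size s = n -> orthonormal_seq s ->
  forall j l : 'I_n, \sum_(p < n) s`_p 0 j * s`_p 0 l = (j == l)%:R.
Proof.
move=> sn so j l; pose Q := \matrix_(i < n) s`_i.
have QQ : Q *m Q^T = 1%:M.
  apply/matrixP => i k; rewrite !mxE -val_eqE -so ?sn ?ltn_ord // dotE. 
  by apply: eq_bigr => p _; rewrite !mxE.
have /matrixP/(_ j l) := mulmx1C QQ; rewrite !mxE => <-.
by apply: eq_bigr => p _; rewrite !mxE.
Qed.

Lemma eval2_trace (s : seq 'rV[R]_n) A : size s = n -> orthonormal_seq s ->
  \sum_(p < n) eval2 A s`_p s`_p = \tr A.
Proof.
move=> sn so; under eq_bigr do rewrite eval2E.
rewrite exchange_big; apply: eq_bigr => i _; rewrite exchange_big (bigD1 i) //=.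
under eq_bigr do rewrite -mulrA.
rewrite -mulr_sumr parseval // eqxx mulr1 big1 ?addr0 // => k /negbTE ki.
under eq_bigr do rewrite -mulrA.
by rewrite -mulr_sumr parseval // eq_sym ki mulr0.
Qed.

(** The contraction defining [Ric] may be taken in any orthonormal basis: by [parseval], summing
    over [p] leaves only the terms with [l = j]. *)
Lemma eval2_Ric (s : seq 'rV[R]_n) T x z : size s = n -> orthonormal_seq s ->
  eval2 (Ric T) x z = \sum_(p < n) eval4 T x s`_p z s`_p.
Proof.
move=> sn so; rewrite eval2E /eval4 [RHS]exchange_big.
apply: eq_bigr => i _; rewrite [RHS]exchange_big /=.
under eq_bigr do rewrite mxE !mulr_suml.
rewrite exchange_big; apply: eq_bigr => j _; rewrite [RHS]exchange_big.
apply: eq_bigr => k _; rewrite [RHS]exchange_big (bigD1 j) //=.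
have E l : \sum_(p < n) T (i, j, k, l) * x 0 i * s`_p 0 j * z 0 k * s`_p 0 l =
    T (i, j, k, l) * x 0 i * z 0 k * (j == l)%:R.
  by rewrite -(parseval _ sn so) mulr_sumr; apply: eq_bigr => p _; ring.
rewrite E eqxx mulr1 big1 ?addr0 // => l /negbTE lj.
by rewrite E eq_sym lj mulr0.
Qed.

End Orthonormal.

(** * Consequences of weakly PIC for sectional curvatures *)

Section WeaklyPIC.
Context {R : realType} {n : nat}.
Implicit Types (x y z w v : 'rV[R]_n).

(** The positions in [f] may come in any order, so this also permutes frames. *)
Lemma orthonormal_subseq (s : seq 'rV[R]_n) (f : seq nat) :
  orthonormal_seq s -> uniq f -> all (fun i => i < size s)%N f ->
  orthonormal_seq [seq s`_i | i <- f].
Proof.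
move=> so uf /all_nthP sf i j; rewrite !size_map => fi fj.
by rewrite !(nth_map 0%N) // so ?sf // nth_uniq.
Qed.

(* The average of the isotropic curvature inequality over the two frames
   (x, y, z, c w + r v) and (x, y, z, c w - r v). *)
Lemma weakly_PIC_tilt (T : curv R n) x y z w v (c r : R) : weakly_PIC T ->
  orthonormal_seq [:: x; y; z; w; v] -> c ^+ 2 + r ^+ 2 = 1 ->
  0 <= sec T x z + sec T y z + c ^+ 2 * (sec T x w + sec T y w)
     + r ^+ 2 * (sec T x v + sec T y v) - 2 * c * eval4 T x y z w.
Proof.
move=> pic so cr1; have D i j := so i j.
have so3 : orthonormal_seq [:: x; y; z].
  exact: (orthonormal_subseq _ [:: 0; 1; 2]%N so).
(* Stated for [e] so as to cover both [r] and [- r]. *)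
have fr (e : R) : e ^+ 2 = r ^+ 2 ->
    orthonormal_seq [:: x; y; z; c *: w + e *: v].
  move=> er; apply: (@orthonormal_rcons _ _ [:: x; y; z]) => // [|i i3].
    have w0 := D 3 3 isT isT; have w1 := D 3 4 isT isT.
    have w2 := D 4 3 isT isT; have w3 := D 4 4 isT isT.
    rewrite /= in w0 w1 w2 w3.
    rewrite dot_linr !(dotC (c *: w + e *: v)) !dot_linr w0 w1 w2 w3.
    by rewrite -[RHS]cr1 -er; ring.
  have -> : [:: x; y; z]`_i = [:: x; y; z; w; v]`_i by case: i i3 => [|[|[|]]].
  have i5 : (i < 5)%N by apply: leq_trans i3 _.
  have := D i 3 i5 isT; have := D i 4 i5 isT.
  rewrite dot_linr /= (ltn_eqF i3) ltn_eqF 1?ltnW // => -> ->.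
  by rewrite !mulr0 addr0.
(* In the sum of the two inequalities the terms odd in [r] cancel. *)
have := pic _ _ _ _ (fr r erefl); have := pic _ _ _ _ (fr (- r) (sqrrN r)).
rewrite -!/(sec _ _ _) !sec_lin !eval4_lin4; lra.
Qed.

(** Averaging over [w] and [- w] cancels the term in [eval4 T x y z w]. *)
Lemma weakly_PIC_sec (T : curv R n) x y z w : weakly_PIC T ->
  orthonormal_seq [:: x; y; z; w] ->
  0 <= sec T x z + sec T x w + sec T y z + sec T y w.
Proof.
move=> pic so; have D i j := so i j.
have so3 : orthonormal_seq [:: x; y; z].
  exact: (orthonormal_subseq _ [:: 0; 1; 2]%N so).
(* [- w] is written as a linear combination so that [dot_linr], [sec_lin] and [eval4_lin4] apply. *)
have so' : orthonormal_seq [:: x; y; z; (-1) *: w + 0 *: w].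
  apply: (@orthonormal_rcons _ _ [:: x; y; z]) => // [|i i3].
    have w0 := D 3 3 isT isT; rewrite /= in w0.
    by rewrite dot_linr !(dotC (-1 *: w + 0 *: w)) !dot_linr w0; ring.
  have -> : [:: x; y; z]`_i = [:: x; y; z; w]`_i by case: i i3 => [|[|[|]]].
  have := D i 3 (ltnW i3) isT.
  by rewrite dot_linr /= (ltn_eqF i3) => ->; rewrite !mulr0 addr0.
have := pic _ _ _ _ so; have := pic _ _ _ _ so'.
rewrite -!/(sec _ _ _) !sec_lin !eval4_lin4; lra.
Qed.

End WeaklyPIC.

(** * Composition and evaluation of the maps l_{a,b} *)

Section Lab.
Context {R : realType} {n : nat} (n0 : n%:R != 0 :> R).

Lemma Ric_lab (a b : R) (T : tensor4 R n) : Ric (lab_tensor a b T) =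
  (1 + b * (n%:R - 2)) *: Ric T
    + ((b + 2 * (n%:R - 1) * (a - b) / n%:R) * scal T) *: 1%:M.
Proof.
rewrite /lab_tensor !RicD !RicZ !Ric_KN1 mxtrace1 -/(scal T).
rewrite -[(scal T)%:M]scalemx1 -[n%:R%:M]scalemx1.
by apply/matrixP => i k; rewrite !mxE; ring.
Qed.

Lemma scal_lab (a b : R) (T : tensor4 R n) :
  scal (lab_tensor a b T) = (1 + 2 * (n%:R - 1) * a) * scal T.
Proof.
rewrite /scal Ric_lab linearD !linearZ /= mxtrace1 -/(scal T) /GRing.scale /=.
by field.
Qed.

(** l_{a,b} scales the scalar curvature by 1 + 2(n-1)a and the traceless Ricci tensor by 1 + (n-2)b;
    under composition these factors multiply. *)
Lemma lab_comp (a1 b1 a2 b2 : R) (T : curv R n) :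
  lab a1 b1 (lab a2 b2 T) =
  lab (a1 + a2 + 2 * (n%:R - 1) * a1 * a2) (b1 + b2 + (n%:R - 2) * b1 * b2) T.
Proof.
apply: val_inj => /=.
rewrite {1}/lab_tensor scal_lab Ric_lab KND !KNZ /lab_tensor.
set A := KN (Ric T) _; set B := KN 1%:M _.
by apply/ffunP => x; rewrite !ffunE /GRing.scale /=; field.
Qed.

Lemma eval4_lab (a b : R) (T : tensor4 R n) x y z w :
  eval4 (lab_tensor a b T) x y z w = eval4 T x y z w
    + b * (eval2 (Ric T) x z * dot y w + eval2 (Ric T) y w * dot x z
           - eval2 (Ric T) x w * dot y z - eval2 (Ric T) y z * dot x w)
    + 2 * ((a - b) / n%:R * scal T) * (dot x z * dot y w - dot x w * dot y z).
Proof.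
by rewrite /lab_tensor !eval4D !eval4Z !eval4_KN !eval2_1; ring.
Qed.

End Lab.

(** * Linear inequalities between the sectional curvatures [k i j] of an orthonormal basis *)

Section SectionalSums.
Context {R : realType} (k : nat -> nat -> R).
Context (kC : forall i j, k i j = k j i) (k0 : forall i, k i i = 0).
Context (kH : forall i j p q, uniq [:: i; j; p; q] ->
  all (fun i => i < 8)%N [:: i; j; p; q] -> 0 <= k i p + k i q + k j p + k j q).

Local Notation kP i j p q := (kH i j p q isT isT).

Let ric i := \sum_(p < 8) k i p.
Let sc := \sum_(i < 8) ric i.

(* Sums of k over the pairs of indices with one end in each of two of the
   blocks a = {0, 1}, b = {2}, c = {3}, d = {4, 5, 6, 7}; below, xy_zt is the
   sum of kH over the quadruples with i, j in x, y and p, q in z, t, or over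
   enough of them to be symmetric in each block. *)
Let aa := k 0 1.
Let ab := k 0 2 + k 1 2.
Let ac := k 0 3 + k 1 3.
Let ad := k 0 4 + k 0 5 + k 0 6 + k 0 7 + k 1 4 + k 1 5 + k 1 6 + k 1 7.
Let bc := k 2 3.
Let bd := k 2 4 + k 2 5 + k 2 6 + k 2 7.
Let cd := k 3 4 + k 3 5 + k 3 6 + k 3 7.
Let dd := k 4 5 + k 4 6 + k 4 7 + k 5 6 + k 5 7 + k 6 7.

Let ricE i :
  ric i = k i 0 + k i 1 + k i 2 + k i 3 + k i 4 + k i 5 + k i 6 + k i 7.
Proof. by rewrite /ric !big_ord_recl big_ord0 /= addr0 !addrA. Qed.

Let ric01 : ric 0 + ric 1 = 2 * aa + ab + ac + ad.
Proof. by rewrite !ricE !k0 (kC 1 0) /aa /ab /ac /ad; ring. Qed.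

Let ric2 : ric 2 = ab + bc + bd.
Proof. by rewrite !ricE !k0 (kC 2 0) (kC 2 1) /ab /bc /bd; ring. Qed.

Let ric3 : ric 3 = ac + bc + cd.
Proof. by rewrite !ricE !k0 (kC 3 0) (kC 3 1) (kC 3 2) /ac /bc /cd; ring. Qed.

Let scE : sc = 2 * (aa + ab + ac + ad + bc + bd + cd + dd).
Proof.
pose kS := (kC 1 0, (kC 2 0, kC 2 1), (kC 3 0, kC 3 1, kC 3 2),
  (kC 4 0, kC 4 1, kC 4 2, kC 4 3), (kC 5 0, kC 5 1, kC 5 2, kC 5 3, kC 5 4),
  (kC 6 0, kC 6 1, kC 6 2, kC 6 3, kC 6 4, kC 6 5),
  (kC 7 0, kC 7 1, kC 7 2, kC 7 3, kC 7 4, kC 7 5, kC 7 6)).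
rewrite /sc !big_ord_recl big_ord0 /= !ricE !k0 addr0 !kS.
by rewrite /aa /ab /ac /ad /bc /bd /cd /dd; ring.
Qed.

Let aa_bc : 0 <= ab + ac.
Proof.
move: (kP 0 1 2 3).
rewrite /aa /ab /ac /ad /bc /bd /cd /dd; lra.
Qed.

Let aa_bd : 0 <= 4 * ab + ad.
Proof.
move: (kP 0 1 2 4) (kP 0 1 2 5) (kP 0 1 2 6) (kP 0 1 2 7).
rewrite /aa /ab /ac /ad /bc /bd /cd /dd; lra.
Qed.

Let aa_dd : 0 <= ad.
Proof.
move: (kP 0 1 4 5) (kP 0 1 6 7).
rewrite /aa /ab /ac /ad /bc /bd /cd /dd; lra.
Qed.

Let ab_ac : 0 <= 2 * aa + ab + ac + 2 * bc.
Proof.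
move: (kP 0 2 1 3) (kP 1 2 0 3).
rewrite (kC 1 0) (kC 2 0) (kC 2 1) /aa /ab /ac /ad /bc /bd /cd /dd; lra.
Qed.

Let ab_ad : 0 <= 8 * aa + 4 * ab + ad + 2 * bd.
Proof.
move: (kP 0 2 1 4) (kP 0 2 1 5) (kP 0 2 1 6) (kP 0 2 1 7) (kP 1 2 0 4)
  (kP 1 2 0 5) (kP 1 2 0 6) (kP 1 2 0 7).
rewrite (kC 1 0) (kC 2 0) (kC 2 1) /aa /ab /ac /ad /bc /bd /cd /dd; lra.
Qed.

Let ac_ad : 0 <= 8 * aa + 4 * ac + ad + 2 * cd.
Proof.
move: (kP 0 3 1 4) (kP 0 3 1 5) (kP 0 3 1 6) (kP 0 3 1 7) (kP 1 3 0 4)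
  (kP 1 3 0 5) (kP 1 3 0 6) (kP 1 3 0 7).
rewrite (kC 1 0) (kC 3 0) (kC 3 1) /aa /ab /ac /ad /bc /bd /cd /dd; lra.
Qed.

Let ac_dd : 0 <= ad + 2 * cd.
Proof.
move: (kP 0 3 4 5) (kP 0 3 6 7) (kP 1 3 4 5) (kP 1 3 6 7).
rewrite /aa /ab /ac /ad /bc /bd /cd /dd; lra.
Qed.

Let ad_ad : 0 <= 12 * aa + 3 * ad + 2 * dd.
Proof.
move: (kP 0 4 1 5) (kP 0 4 1 6) (kP 0 4 1 7) (kP 0 5 1 4) (kP 0 5 1 6)
  (kP 0 5 1 7) (kP 0 6 1 4) (kP 0 6 1 5) (kP 0 6 1 7) (kP 0 7 1 4)
  (kP 0 7 1 5) (kP 0 7 1 6).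
rewrite (kC 4 1) (kC 5 1) (kC 5 4) (kC 6 1) (kC 6 4) (kC 6 5) (kC 7 1)
  (kC 7 4) (kC 7 5) (kC 7 6) /aa /ab /ac /ad /bc /bd /cd /dd; lra.
Qed.

Let bc_dd : 0 <= bd + cd.
Proof.
move: (kP 2 3 4 5) (kP 2 3 6 7).
rewrite /aa /ab /ac /ad /bc /bd /cd /dd; lra.
Qed.

Let dd_dd : 0 <= dd.
Proof.
move: (kP 4 5 6 7) (kP 4 6 5 7) (kP 4 7 5 6).
rewrite (kC 6 5) (kC 7 5) (kC 7 6) /aa /ab /ac /ad /bc /bd /cd /dd; lra.
Qed.

(** The expression is the isotropic curvature of S minus that of T on the frame. *)
Lemma isotropic_sums_ge0 (b c : R) : b = 11 / 414 ->
  c = ((712 * 800 / (369 * 1101) - 1) / 14 - 11 / 414) / 8 ->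
  0 <= 2 * b * (ric 0 + ric 1 + ric 2 + ric 3) + 8 * c * sc.
Proof.
move=> -> ->; rewrite ric01 ric2 ric3 scE.
move: aa_bc aa_bd aa_dd ab_ac ab_ad ac_ad ac_dd ad_ad bc_dd dd_dd.
lra.
Qed.

(** The expression is A - w minus the mean of the right-hand sides of the four tilted inequalities
    with coefficient 1/2 on e_4, and likewise for A + w with coefficient -1/2. The weight 3/16 is a
    quarter of 3/4. *)
Lemma half_tilt_sums_ge0 (b c s : R) : b = 11 / 414 ->
  c = ((712 * 800 / (369 * 1101) - 1) / 14 - 11 / 414) / 8 ->
  23 / 100 <= s <= 24 / 100 ->
  0 <= b * (ric 0 + ric 1 + 2 * ric 2) + 4 * c * sc
    + s * ((1 + 6 * b) * (ric 0 + ric 1) + 2 * (b + 14 * c) * sc)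
    - ((k 0 3 + k 1 3) / 4
       + 3 / 16 * (k 0 4 + k 0 5 + k 0 6 + k 0 7 + k 1 4 + k 1 5 + k 1 6 + k 1 7)).
Proof.
move=> -> -> /andP[s1 s2]; rewrite -/ac -/ad ric01 ric2 scE.
move: aa_bc aa_bd aa_dd ab_ac ab_ad ac_ad ac_dd ad_ad bc_dd dd_dd.
set X := (X in s * X); set U := (X in X + s * _); set V := (X in _ - X).
do 10! move=> ?.
(* The expression is affine in [s], so the two rational endpoints suffice. *)
have lo : 0 <= U + 23 / 100 * X - V by rewrite /U /X /V; lra.
have hi : 0 <= U + 24 / 100 * X - V by rewrite /U /X /V; lra.
nra.
Qed.

End SectionalSums.

(** * Assembly of the estimate in dimension eight *)

Theorem claim6p1 (R : realType) (T : curv R 8) :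
  let bmax : R := 1 / 18 in
  let amax : R := 49 / 738 in
  let tbmax : R := 1 / 40 in
  let tamax : R := 43 / 1600 in
  let S : curv R 8 := lab_inv tamax tbmax (lab amax bmax T) in
  let s : R := Num.sqrt (2 * tamax) in
  weakly_PIC T ->
  forall e1 e2 e3 e4 : 'rV[R]_8, orthonormal_seq [:: e1; e2; e3; e4] ->
  forall lam : R, 0 <= lam <= 1 ->
    0 <= eval4 S e1 e3 e1 e3 + eval4 S e2 e3 e2 e3
       + lam ^+ 2 * (eval4 S e1 e4 e1 e4 + eval4 S e2 e4 e2 e4)
       - 2 * lam * eval4 S e1 e2 e3 e4
       + s * (1 - lam ^+ 2) * (eval2 (Ric S) e1 e1 + eval2 (Ric S) e2 e2).
Proof.
move=> bmax amax tbmax tamax S s pic e1 e2 e3 e4 so lam /andP[lam0 lam1].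
have s0 : 0 <= s by exact: sqrtr_ge0.
have s2 : s ^+ 2 = 2 * tamax by rewrite sqr_sqrtr // /tamax; lra.
have sB : 23 / 100 <= s <= 24 / 100.
  by apply/andP; split; rewrite -ler_sqr ?nnegrE ?s2 /tamax //; lra.
(* [r] is the coefficient sqrt 3 / 2 of e_p in the tilted frames. *)
have [r r2] : exists r : R, r ^+ 2 = 3 / 4.
  by exists (Num.sqrt (3 / 4)); rewrite sqr_sqrtr //; lra.
(* a and b solve 1 + 14 amax = (1 + 14 tamax) (1 + 14 a) and
   1 + 6 bmax = (1 + 6 tbmax) (1 + 6 b), and c = (a - b) / 8. *)
pose b : R := 11 / 414; pose a : R := (712 * 800 / (369 * 1101) - 1) / 14.
pose c : R := ((712 * 800 / (369 * 1101) - 1) / 14 - 11 / 414) / 8.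
have n0 : 8%:R != 0 :> R by rewrite pnatr_eq0.
have SE : S = lab a b T.
  have -> : S = lab_inv tamax tbmax (lab tamax tbmax (lab a b T)).
    rewrite lab_comp // /S; congr (lab_inv _ _ (lab _ _ T)).
      by rewrite /amax /tamax /a; lra.
    by rewrite /bmax /tbmax /b; lra.
  by rewrite labK // /tamax /tbmax; apply/andP; split; lra.
have [t [t4 so8]] := orthonormal_extend [:: e1; e2; e3; e4] 4 isT so.
case: t t4 so8 => [|e5 [|e6 [|e7 [|e8 [|//]]]]] // _.
set e := (_ ++ _) => so8.
pose k i j := sec T e`_i e`_j.
have kC i j : k i j = k j i by exact: secC.
have k0 i : k i i = 0 by exact: sec_xx.
have kH i j p q : uniq [:: i; j; p; q] ->
    all (fun i => i < 8)%N [:: i; j; p; q] ->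
    0 <= k i p + k i q + k j p + k j q.
  move=> f8 fu; apply: weakly_PIC_sec => //.
  exact: (orthonormal_subseq _ [:: i; j; p; q] so8).
pose ric i := \sum_(p < 8) k i p.
have ricE i : eval2 (Ric T) e`_i e`_i = ric i by exact: eval2_Ric.
have scE : scal T = \sum_(i < 8) ric i.
  by rewrite /scal -(eval2_trace e) //; apply: eq_bigr => i _; exact: ricE.
have secS i j : (i < 8)%N -> (j < 8)%N -> i != j ->
    eval4 S e`_i e`_j e`_i e`_j =
    k i j + b * (ric i + ric j) + 2 * c * scal T.
  move=> i8 j8 /negbTE ij; rewrite SE eval4_lab !ricE !so8 // eq_sym ij !eqxx.
  by rewrite /k /sec /c /a /b /=; ring.
have RicS i : (i < 8)%N -> eval2 (Ric S) e`_i e`_i =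
    (1 + 6 * b) * ric i + (b + 14 * c) * scal T.
  move=> i8; rewrite SE Ric_lab eval2D !eval2Z eval2_1 ricE so8 // eqxx.
  by rewrite /c /a /b /=; lra.
have S1234 : eval4 S e1 e2 e3 e4 = eval4 T e1 e2 e3 e4.
  (* Every correction term contains an inner product of two distinct frame vectors. *)
  have D i j := so i j.
  rewrite SE eval4_lab (D 0 2 isT isT) (D 1 3 isT isT) (D 0 3 isT isT).
  by rewrite (D 1 2 isT isT) /=; ring.
set w := eval4 T e1 e2 e3 e4 in S1234.
have tilt d p : (3 < p < 8)%N -> d ^+ 2 = 1 / 4 ->
    0 <= k 0 2 + k 1 2 + (k 0 3 + k 1 3) / 4 + 3 / 4 * (k 0 p + k 1 p)
         - 2 * d * w.
  move=> /andP[p3 p8] d2.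
  have so5 : orthonormal_seq [:: e1; e2; e3; e4; e`_p].
    apply: (orthonormal_subseq _ [:: 0; 1; 2; 3; p]%N so8); last first.
      by rewrite /= p8.
    by rewrite /= !inE; case: p p3 {p8} => [|[|[|[|p]]]].
  have dr : d ^+ 2 + r ^+ 2 = 1 by rewrite d2 r2; lra.
  have := weakly_PIC_tilt T _ _ _ _ _ d r pic so5 dr.
  by rewrite d2 r2 -/w mulrC mul1r.
have iso := isotropic_sums_ge0 k kC k0 kH b c erefl erefl.
have half := half_tilt_sums_ge0 k kC k0 kH b c s erefl erefl sB.
rewrite -/(ric 0) -/(ric 1) -/(ric 2) -/(ric 3) -!scE in iso half.
have S13 : eval4 S e1 e3 e1 e3 = _ := secS 0 2 isT isT isT.
have S23 : eval4 S e2 e3 e2 e3 = _ := secS 1 2 isT isT isT.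
have S14 : eval4 S e1 e4 e1 e4 = _ := secS 0 3 isT isT isT.
have S24 : eval4 S e2 e4 e2 e4 = _ := secS 1 3 isT isT isT.
have Ric1 : eval2 (Ric S) e1 e1 = _ := RicS 0 isT.
have Ric2 : eval2 (Ric S) e2 e2 = _ := RicS 1 isT.
have A_w d : d ^+ 2 = 1 / 4 ->
    0 <= eval4 S e1 e3 e1 e3 + eval4 S e2 e3 e2 e3
       + s * (eval2 (Ric S) e1 e1 + eval2 (Ric S) e2 e2) - 2 * d * w.
  (* The mean of the four tilted inequalities plus [half]; [d] is 1/2 or -1/2, which gives A - w or
     A + w. *)
  move=> d2; have := tilt d 4 isT d2; have := tilt d 5 isT d2.
  have := tilt d 6 isT d2; have := tilt d 7 isT d2.
  rewrite S13 S23 Ric1 Ric2.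
  move: half; clear; clearbody b c k ric w; lra.
have P : 0 <= eval4 S e1 e3 e1 e3 + eval4 S e1 e4 e1 e4
            + eval4 S e2 e3 e2 e3 + eval4 S e2 e4 e2 e4 - 2 * w.
  (* Weak PIC of T on the given frame, to which [iso] is added. *)
  have : 0 <= k 0 2 + k 0 3 + k 1 2 + k 1 3 - 2 * w := pic _ _ _ _ so.
  rewrite S13 S14 S23 S24.
  move: iso; clear; clearbody b c k ric w; lra.
have q : (1 / 2) ^+ 2 = 1 / 4 :> R by field.
have Am := A_w (1 / 2) q; have Ap := A_w (- (1 / 2)) (etrans (sqrrN _) q).
(* A is the mean of A - w and A + w. *)
have A0 : 0 <= eval4 S e1 e3 e1 e3 + eval4 S e2 e3 e2 e3
            + s * (eval2 (Ric S) e1 e1 + eval2 (Ric S) e2 e2).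
  by move: Am Ap; clear; clearbody w; lra.
have := mulr_ge0 (sqr_ge0 (1 - lam)) A0.
have lam' : 0 <= 2 * lam * (1 - lam) by rewrite !mulr_ge0 ?subr_ge0.
have := mulr_ge0 lam' Am; have := mulr_ge0 (sqr_ge0 lam) P.
rewrite S1234; clear; clearbody w; lra.
Qed.
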